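(* Let $M$ be a compact Riemannian manifold, $E$ a vector bundle over $M$, and $\nabla$ a connection in $\mathcal W(E)$. Then $$\exp\Big(\frac1{\mathrm{Volume}(M)}\int_M\frac{\|R^\nabla\|^2}{2}\,dv\Big)-1\le\frac1{\mathrm{Volume}(M)}\int_M\Big(\exp\big(\tfrac{\|R^\nabla\|^2}{2}\big)-1\Big)dv,$$ that is, $$\exp\Big(\frac1{\mathrm{Volume}(M)}\mathcal{YM}(\nabla)\Big)-1\le\frac1{\mathrm{Volume}(M)}\mathcal{YM}_e^0(\nabla).$$ Equality holds if and only if $\|R^\nabla\|$ is constant almost everywhere.
   Context: $E$ is equipped with a fiber metric. For a connection $\nabla$ on $E$, $R^\nabla$ is its curvature and, at $x\in M$, $\|R^\nabla\|^2=\sum_{i<j}\|R^\nabla_{e_i,e_j}\|^2$ for an orthonormal basis $\{e_i\}$ of $T_xM$, with the norm on $\mathrm{Hom}(E,E)$ given by $\langle S,U\rangle=\mathrm{trace}(S^T\circ U)$. The Yang-Mills functional is $\mathcal{YM}(\nabla)=\int_M\frac12\|R^\nabla\|^2dv$, and the normalized exponential Yang-Mills functional is $\mathcal{YM}_e^0(\nabla)=\int_M\big(\exp(\frac12\|R^\nabla\|^2)-1\big)dv$. $\mathcal L_1^p(E)$ denotes the Sobolev space of connections of $E$ which are $p$-integrable together with their first derivatives, and $$\mathcal W(E)=\bigcap_{p\ge1}\mathcal L_1^p(E)\cap\{\nabla:\mathcal{YM}_e^0(\nabla)<\infty\}.$$ *)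

(* Defs.v *)
From mathcomp Require Import all_boot all_order all_algebra.
From mathcomp Require Import all_classical all_reals all_analysis.

Set Implicit Arguments.
Unset Strict Implicit.
Unset Printing Implicit Defensive.

Import Order.TTheory GRing.Theory Num.Theory.
Import numFieldNormedType.Exports.

Local Open Scope classical_set_scope.
Local Open Scope ring_scope.

(* Points of R^n are row vectors for calculus and linear algebra, and tuples
   for measure theory, where the library provides the product sigma-algebra;
   [row_of_tuple] identifies the two. *)

Definition cons_pair (R : realType) (n : nat)
    (p : n.-tuple (measurableTypeR R) * measurableTypeR R) :
    n.+1.-tuple (measurableTypeR R) :=
  [the n.+1.-tuple _ of p.2 :: p.1].

Lemma measurable_cons_pair (R : realType) (n : nat) :
  measurable_fun [set: n.-tuple (measurableTypeR R) * measurableTypeR R]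
    (@cons_pair R n).
Proof. exact: (measurable_cons measurable_snd measurable_fst). Qed.

(* The n-fold product of the one-dimensional Lebesgue measure.  The long
   constant is the library's measure structure on [pushforward]; it is named
   in order to supply the measurability proof. *)
Fixpoint lebesgue_tuple (R : realType) (n : nat) :
    {measure set (n.-tuple (measurableTypeR R)) -> \bar R} :=
  match n with
  | 0 => @dirac _ (0.-tuple (measurableTypeR R)) [tuple] R
  | m.+1 => measure_function_pushforward__canonical__measure_function_Measure
              (lebesgue_tuple R m \x @lebesgue_measure R)%E
              (@measurable_cons_pair R m)
  end.

Definition row_of_tuple (R : realType) (n : nat)
    (t : n.-tuple (measurableTypeR R)) : 'rV[R]_n := \row_i tnth t i.

Section Calculus.
Context (R : realType) (n : nat).

Definition basis_vec (k : 'I_n) : 'rV[R]_n := delta_mx 0 k.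

Fixpoint Ck_on (W : normedModType R) (k : nat) (U : set 'rV[R]_n)
    (f : 'rV[R]_n -> W) : Prop :=
  (forall v, U v -> {for v, continuous f}) /\
  match k with
  | 0 => True
  | m.+1 => forall j : 'I_n,
      (forall v, U v -> derivable f v (basis_vec j)) /\
      Ck_on m U (fun v => 'D_(basis_vec j) f v)
  end.

Definition smooth_on (W : normedModType R) (U : set 'rV[R]_n)
    (f : 'rV[R]_n -> W) := forall k, Ck_on k U f.

Definition Lp_loc (p : R) (U : set 'rV[R]_n) (u : 'rV[R]_n -> R) :=
  measurable_fun (@row_of_tuple R n @^-1` U)
    (u \o @row_of_tuple R n : _ -> measurableTypeR R) /\
  forall K, compact K -> K `<=` U ->
    (\int[lebesgue_tuple R n]_(t in @row_of_tuple R n @^-1` K)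
       (`|u (row_of_tuple t)| `^ p)%:E < +oo)%E.

Definition test_function (U : set 'rV[R]_n) (f : 'rV[R]_n -> R) :=
  smooth_on [set: 'rV[R]_n] f /\
  exists K, [/\ compact K, K `<=` U & forall v, ~ K v -> f v = 0].

Definition weak_partial (k : 'I_n) (U : set 'rV[R]_n)
    (u w : 'rV[R]_n -> R) :=
  forall f, test_function U f ->
    \int[lebesgue_tuple R n]_(t in @row_of_tuple R n @^-1` U)
      (u (row_of_tuple t) * 'D_(basis_vec k) f (row_of_tuple t)) =
    - \int[lebesgue_tuple R n]_(t in @row_of_tuple R n @^-1` U)
        (w (row_of_tuple t) * f (row_of_tuple t)).

Definition sobolev1_loc (p : R) (U : set 'rV[R]_n) (u : 'rV[R]_n -> R) :=
  Lp_loc p U u /\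
  forall k, exists2 w, Lp_loc p U w & weak_partial k U u w.

End Calculus.

(* A smooth structure on the topological space M, given by an atlas of charts
   [phi i : dom i -> R^n] with inverses [psi i]. *)
Record atlas (R : realType) (n : nat) (M : ptopologicalType) := Atlas {
  chart : Type;
  dom : chart -> set M;
  phi : chart -> M -> 'rV[R]_n;
  psi : chart -> 'rV[R]_n -> M;
  dom_open : forall i, open (dom i);
  dom_cover : forall x, exists i, dom i x;
  phi_open : forall i, open (phi i @` dom i);
  phiK : forall i x, dom i x -> psi i (phi i x) = x;
  phi_continuous : forall i x, dom i x -> {for x, continuous (phi i)};
  psi_continuous : forall i v, (phi i @` dom i) v ->
    {for v, continuous (psi i)};
  transition_smooth : forall i j,
    smooth_on (phi i @` (dom i `&` dom j)) (phi j \o psi i) }.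

(* The library's Jacobian acts on row vectors from the right: the coordinates
   [v] of a tangent vector in chart [i] become [v *m jac i j x] in chart [j],
   and d/dx_i^k = \sum_l jac i j x k l * d/dx_j^l. *)
Definition jac (R : realType) (n : nat) (M : ptopologicalType)
    (A : atlas R n M) (i j : chart A) (x : M) : 'M[R]_n :=
  jacobian (phi j \o psi i) (phi i x).

(* [gmat i x] is the Gram matrix at [x] of the coordinate frame of chart [i]. *)
Record riemannian_metric (R : realType) (n : nat) (M : ptopologicalType)
    (A : atlas R n M) := RiemannianMetric {
  gmat : chart A -> M -> 'M[R]_n;
  gmat_smooth : forall i, smooth_on (phi i @` dom i) (gmat i \o psi i);
  gmat_sym : forall i x, dom i x -> (gmat i x)^T = gmat i x;
  gmat_pos : forall i x (v : 'rV[R]_n), dom i x -> v != 0 ->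
    0 < (v *m gmat i x *m v^T) 0 0;
  gmat_change : forall i j x, dom i x -> dom j x ->
    gmat i x = jac i j x *m gmat j x *m (jac i j x)^T }.

Definition borel (M : ptopologicalType) : measurableType (@open M).-sigma :=
  g_sigma_algebraType (@open M).

(* The Riemannian measure dv is the Borel measure whose density in each chart
   is sqrt (det g). *)
Definition is_riemannian_volume (R : realType) (n : nat)
    (M : ptopologicalType) (A : atlas R n M) (g : riemannian_metric A)
    (mu : {measure set (borel M) -> \bar R}) :=
  forall (i : chart A) (B : set (borel M)), measurable B -> B `<=` dom i ->
    mu B = (\int[lebesgue_tuple R n]_(t in
              @row_of_tuple R n @^-1` (phi i @` B))
              (Num.sqrt (\det (gmat g i (psi i (row_of_tuple t)))))%:E)%E.

(* A real vector bundle of rank r, presented by local frames over an open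
   cover and their transition functions: a section with components (column
   vectors) [s_a] in frame [a] satisfies s_a = trans a b *m s_b. *)
Record vector_bundle (R : realType) (n : nat) (M : ptopologicalType)
    (A : atlas R n M) (r : nat) := VectorBundle {
  frame : Type;
  fdom : frame -> set M;
  trans : frame -> frame -> M -> 'M[R]_r;
  fdom_open : forall a, open (fdom a);
  fdom_cover : forall x, exists a, fdom a x;
  trans_smooth : forall a b (i : chart A),
    smooth_on (phi i @` (dom i `&` (fdom a `&` fdom b)))
      (trans a b \o psi i);
  trans_id : forall a x, fdom a x -> trans a a x = 1%:M;
  trans_cocycle : forall a b c x, fdom a x -> fdom b x -> fdom c x ->
    trans a b x *m trans b c x = trans a c x }.

Section Bundle.
Context (R : realType) (n r : nat) (M : ptopologicalType) (A : atlas R n M).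
Context (E : vector_bundle A r).

(* [hmat a x] is the Gram matrix of the fiber metric in frame [a]. *)
Record fiber_metric := FiberMetric {
  hmat : frame E -> M -> 'M[R]_r;
  hmat_smooth : forall a (i : chart A),
    smooth_on (phi i @` (dom i `&` fdom a)) (hmat a \o psi i);
  hmat_sym : forall a x, fdom a x -> (hmat a x)^T = hmat a x;
  hmat_pos : forall a x (s : 'cV[R]_r), fdom a x -> s != 0 ->
    0 < (s^T *m hmat a x *m s) 0 0;
  hmat_change : forall a b x, fdom a x -> fdom b x ->
    hmat b x = (trans a b x)^T *m hmat a x *m trans a b x }.

(* A (not necessarily smooth) connection, presented by its connection forms:
   for X = d/dx_i^k, (nabla_X s)_a = X s_a + form a i k *m s_a. *)
Record connection := Connection {
  form : frame E -> chart A -> 'I_n -> M -> 'M[R]_r;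
  form_frame_change : forall a b (i : chart A) k x, dom i x -> fdom a x -> fdom b x ->
    trans a b x *m form b i k x =
    'D_(basis_vec R k) (trans a b \o psi i) (phi i x)
    + form a i k x *m trans a b x;
  form_chart_change : forall a (i j : chart A) k x, dom i x -> dom j x -> fdom a x ->
    form a i k x = \sum_l jac i j x k l *: form a j l x }.

(* The region of R^n where frame [a] and chart [i] are both defined. *)
Definition patch (a : frame E) (i : chart A) : set 'rV[R]_n :=
  phi i @` (dom i `&` fdom a).

Definition form_entry (nabla : connection) (a : frame E) (i : chart A)
    (k : 'I_n) (s t : 'I_r) (v : 'rV[R]_n) : R :=
  form nabla a i k (psi i v) s t.

(* Membership in L_1^p(E).  As M is compact, belonging globally to the Sobolev
   class is the same as belonging to it on compact subsets of every patch. *)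
Definition sobolev_connection (p : R) (nabla : connection) :=
  forall a i k s t,
    sobolev1_loc p (patch a i) (form_entry nabla a i k s t).

(* Components of End(E)-valued 2-tensors: [F a i k l x] is the matrix, in
   frame [a], of F(d/dx_i^k, d/dx_i^l) at [x]. *)
Definition end_tensor2 := frame E -> chart A -> 'I_n -> 'I_n -> M -> 'M[R]_r.

(* [F] is a Borel section of Lambda^2 T*M (x) End(E). *)
Definition is_end_2form (F : end_tensor2) :=
  [/\ forall a i k l s t,
        measurable_fun (dom i `&` fdom a : set (borel M))
          ((fun x => F a i k l x s t) : borel M -> measurableTypeR R),
      forall a i k l x, dom i x -> fdom a x -> F a i k l x = - F a i l k x,
      forall a b i k l x, dom i x -> fdom a x -> fdom b x ->
        trans a b x *m F b i k l x = F a i k l x *m trans a b x &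
      forall a i j k l x, dom i x -> dom j x -> fdom a x ->
        F a i k l x =
        \sum_p \sum_q (jac i j x k p * jac i j x l q) *: F a j p q x].

(* Almost everywhere, R_kl = d_k A_l - d_l A_k + [A_k, A_l] where A denotes the
   connection form and d_k its weak partial derivatives. *)
Definition is_curvature (nabla : connection) (F : end_tensor2) :=
  is_end_2form F /\
  forall a i, exists dform : 'I_n -> 'I_n -> 'rV[R]_n -> 'M[R]_r,
    (forall k l s t,
       Lp_loc 1 (patch a i) (fun v => dform k l v s t) /\
       weak_partial k (patch a i) (form_entry nabla a i l s t)
         (fun v => dform k l v s t)) /\
    forall k l,
      {ae lebesgue_tuple R n, forall t, patch a i (row_of_tuple t) ->
        let v := row_of_tuple t in let x := psi i v in
        F a i k l x = dform k l v - dform l k v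
          + (form nabla a i k x *m form nabla a i l x
             - form nabla a i l x *m form nabla a i k x)}.

(* R^nabla is determined up to a null set; [curvature] chooses a
   representative.  The default value is only taken for connections without
   enough regularity to have a curvature. *)
Definition curvature (nabla : connection) : end_tensor2 :=
  xget (fun _ _ _ _ _ => 0) [set F | is_curvature nabla F].

Definition tensor_eval (F : end_tensor2) (a : frame E) (i : chart A) (x : M)
    (u v : 'rV[R]_n) : 'M[R]_r :=
  \sum_k \sum_l (u 0 k * v 0 l) *: F a i k l x.

(* Matrix of the adjoint S^T of the endomorphism S with respect to the inner
   product with Gram matrix H. *)
Definition adjoint_mx (H S : 'M[R]_r) : 'M[R]_r := invmx H *m S^T *m H.

Definition end_inner (H S U : 'M[R]_r) : R := \tr (adjoint_mx H S *m U).

Context (g : riemannian_metric A) (h : fiber_metric).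

(* The rows of [P] are the coordinates of a basis e_1, ..., e_n of T_x M. *)
Definition orthonormal_basis (i : chart A) (x : M) (P : 'M[R]_n) :=
  P *m gmat g i x *m P^T = 1%:M.

Definition normsq_in_basis (F : end_tensor2) (a : frame E) (i : chart A)
    (x : M) (P : 'M[R]_n) : R :=
  \sum_(k < n) \sum_(l < n | (k < l)%N)
    let S := tensor_eval F a i x (row k P) (row l P) in
    end_inner (hmat h a x) S S.

(* ||R^nabla||^2 at x.  The value depends neither on the frame, nor on the
   chart, nor on the orthonormal basis. *)
Definition curv_normsq (nabla : connection) (x : M) : R :=
  xget 0 [set y | exists a i P, [/\ dom i x, fdom a x,
    orthonormal_basis i x P & y = normsq_in_basis (curvature nabla) a i x P]].

Definition curv_norm (nabla : connection) (x : M) : R :=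
  Num.sqrt (curv_normsq nabla x).

Context (mu : {measure set (borel M) -> \bar R}).

Definition YM (nabla : connection) : \bar R :=
  (\int[mu]_x (curv_normsq nabla x / 2)%:E)%E.

Definition YMe0 (nabla : connection) : \bar R :=
  (\int[mu]_x (expR (curv_normsq nabla x / 2) - 1)%:E)%E.

Definition in_W (nabla : connection) :=
  (forall p : R, 1 <= p -> sobolev_connection p nabla) /\
  (YMe0 nabla < +oo)%E.

End Bundle.

(* Main.v *)
Require Import Defs.
From mathcomp Require Import all_boot all_order all_algebra.
From mathcomp Require Import all_classical all_reals all_analysis.
From mathcomp Require Import finmap measurable_realfun ring lra.
Set Implicit Arguments.
Unset Strict Implicit.
Unset Printing Implicit Defensive.

Import Order.TTheory GRing.Theory Num.Theory.
Import numFieldNormedType.Exports.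
Local Open Scope classical_set_scope.
Local Open Scope ring_scope.

(** The inequality is Jensen's inequality for the strictly convex function exp
    and the normalized Riemannian measure.  Writing f = ||R||^2 / 2 and c for
    the mean of f, the gap between exp f and the tangent line of exp at c is
    nonnegative; its integral is the difference of the two sides (up to the
    factor vol(M)), and it vanishes exactly when f = c almost everywhere.  This
    is [expR_jensen].

    For Jensen's inequality, and above all for its equality case, f has to be a
    nonnegative measurable function on a space of finite measure.

    Measurability ([measurable_curv_normsq]): near any point, f is a polynomial
    in the components of the curvature, which are Borel, the inverse Gram
    matrices of the two metrics, which are continuous, and the fiber metric.
    This is seen from the classical formula
      ||R||^2 = 1/2 sum g^{pp'} g^{qq'} <R_pq, R_p'q'>,
    valid in every chart and frame ([curv_normsq_gram]).  Its proof shows that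
    the right-hand side is the sum over any orthonormal basis, and that such
    bases exist.  The representative of the curvature is a Borel 2-form by
    [curvature_is_end_2form].

    Nonnegativity ([curv_normsq_ge0]): <S, S> = trace (S^T S) is a sum of
    squares in an orthonormal frame of the fiber.

    Finite volume ([riemannian_volume_lty]): a point has a neighborhood that a
    chart maps into a cube and on which det g is bounded, and by compactness
    finitely many such neighborhoods cover M. *)

(** * Jensen's inequality for the exponential *)

Lemma expR_tangent_eq (R : realType) (c y : R) :
  (expR y == expR c + expR c * (y - c)) = (y == c).
Proof.
apply/eqP/eqP => [E|->]; last by rewrite subrr mulr0 addr0.
apply/eqP; rewrite -subr_eq0; apply/negPn/negP => /expR_gt1Dx.
rewrite expRD expRN ltNge => /negP; apply.
rewrite -(ler_pM2l (expR_gt0 c)) mulrDr mulr1 -E mulrCA mulfV ?mulr1 //.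
by rewrite gt_eqF // expR_gt0.
Qed.

Lemma expR_tangent_le (R : realType) (c y : R) :
  expR c + expR c * (y - c) <= expR y.
Proof.
have := expR_ge1Dx (y - c); rewrite -(ler_pM2l (expR_gt0 c)) mulrDr mulr1.
by move=> /le_trans; apply; rewrite -expRD addrC subrK.
Qed.

(** The case of a null space holds by the conventions x / 0 = x * +oo and
    0 * +oo = 0: both sides are then 0, and every property holds almost
    everywhere. *)
Lemma expR_jensen d (T : measurableType d) (R : realType)
    (mu : {measure set T -> \bar R}) (f : T -> R) :
  measurable_fun setT f -> (forall x, 0 <= f x) ->
  (mu setT < +oo)%E -> (\int[mu]_x (expR (f x) - 1)%:E < +oo)%E ->
  (expeR (\int[mu]_x (f x)%:E / mu setT) - 1
     <= \int[mu]_x (expR (f x) - 1)%:E / mu setT)%E /\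
  ((expeR (\int[mu]_x (f x)%:E / mu setT) - 1
      = \int[mu]_x (expR (f x) - 1)%:E / mu setT)%E <->
   exists c : R, {ae mu, forall x, f x = c}).
Proof.
move=> mf f0 muoo Ioo.
have mG : measurable_fun setT (fun x => expR (f x) - 1).
  by apply: measurable_funB => //; exact: measurableT_comp.
have fG x : f x <= expR (f x) - 1 by have := expR_ge1Dx (f x); lra.
have G0 x : 0 <= expR (f x) - 1 by exact: le_trans (f0 x) (fG x).
have iG : mu.-integrable setT (EFin \o (fun x => expR (f x) - 1)).
  apply/integrableP; split; first exact/measurable_EFinP.
  rewrite (eq_integral (fun x => (expR (f x) - 1)%:E)) // => x _.
  by rewrite /= ger0_norm.
have if_ : mu.-integrable setT (EFin \o f).
  apply: (le_integrable _ _ _ iG) => //; first exact/measurable_EFinP.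
  by move=> x _ /=; rewrite lee_fin !ger0_norm.
have [mu0|mu0] := eqVneq (mu setT) 0%E.
  rewrite !(@null_set_integral _ _ _ _ setT) //; first last.
  - exact/measurable_EFinP.
  - exact/measurable_EFinP.
  rewrite !mul0e expeR0 subee //; split=> //; split=> // _.
  by exists 0; exists setT; split.
have fmu : mu setT \is a fin_num by rewrite ge0_fin_numE.
pose m := fine (mu setT).
have Em : mu setT = m%:E by rewrite fineK.
have m0 : 0 < m.
  by rewrite -lte_fin -Em lt0e mu0 measure_ge0.
have mV : (mu setT)^-1%E = (m^-1)%:E by rewrite Em inver gt_eqF.
pose a := fine (\int[mu]_x (f x)%:E).
have Ea : (\int[mu]_x (f x)%:E)%E = a%:E by rewrite fineK // integrable_fin_num.
pose b := fine (\int[mu]_x (expR (f x) - 1)%:E).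
have Eb : (\int[mu]_x (expR (f x) - 1)%:E)%E = b%:E.
  by rewrite fineK // integrable_fin_num.
pose c := a / m.
have cm : c * m = a by rewrite /c divfK // gt_eqF.
(* the gap between exp and its tangent line at the mean value c *)
pose e x := expR (f x) - (expR c + expR c * (f x - c)).
have e0 x : 0 <= e x by rewrite subr_ge0 expR_tangent_le.
have me : measurable_fun setT e.
  rewrite /e; apply: measurable_funB; first exact: measurableT_comp.
  apply: measurable_funD => //; apply: measurable_funM => //.
  exact: measurable_funB.
have ic k : mu.-integrable setT (EFin \o cst k).
  apply/integrableP; split; first exact/measurable_EFinP.
  by rewrite (eq_integral (cst `|k|%:E)) // integral_cst // Em -EFinM ltry.
(* the linear term of the tangent integrates to 0, as c is the mean of f *)
have Ie : (\int[mu]_x (e x)%:E)%E = (b - m * (expR c - 1))%:E.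
  transitivity (\int[mu]_x ((EFin \o (fun x => expR (f x) - 1)%R) x
     + (EFin \o (fun x => - expR c * f x + (expR c * c - expR c + 1))%R) x))%E.
    by apply: eq_integral => x _ /=; rewrite -EFinD /e; congr EFin; ring.
  have i1 : mu.-integrable setT (EFin \o (fun x => - expR c * f x)).
    have := integrableZl measurableT (- expR c) if_.
    by apply: eq_integrable => // x _.
  rewrite integralD_EFin //=; last first.
    have := integrableD measurableT i1 (ic (expR c * c - expR c + 1)).
    exact: eq_integrable.
  rewrite Eb integralD_EFin //=; last exact: ic.
  under eq_integral do rewrite EFinM.
  rewrite integralZl // Ea (integral_cst mu measurableT) Em -!EFinM -!EFinD.
  by congr EFin; rewrite -cm; ring.
(* an almost everywhere constant function equals its mean *)
have ae_c k : {ae mu, forall x, f x = k} -> k = c.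
  move=> fk; apply: (mulIf (lt0r_neq0 m0)); rewrite cm.
  apply: EFin_inj; rewrite -Ea EFinM -Em -integral_cst //.
  apply: ae_eq_integral => //; first exact/measurable_EFinP.
  by apply: filterS fk => x /= -> _.
rewrite Ea Eb mV -!EFinM /= -EFinB lee_fin.
split.
  rewrite ler_pdivlMr // mulrC -subr_ge0.
  by rewrite -lee_fin -Ie integral_ge0 // => x _; rewrite lee_fin.
have E0 : (\int[mu]_x (e x)%:E = 0)%E <-> {ae mu, forall x, f x = c}.
  have := ae_eq_integral_abs mu measurableT ((measurable_EFinP _ _).2 me).
  under eq_integral do rewrite /= ger0_norm //.
  move=> ->; split; apply: filterS => x /=.
    move=> /(_ I) [] /eqP; rewrite subr_eq0 expR_tangent_eq => /eqP //.
  by move=> fx _; congr EFin; apply/eqP; rewrite subr_eq0 expR_tangent_eq fx.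
have EE : (expR (a / m) - 1)%:E = (b / m)%:E <-> (\int[mu]_x (e x)%:E = 0)%E.
  rewrite Ie; split=> [[]|[]] H; congr EFin.
    by rewrite H mulrC divfK ?subrr // gt_eqF.
  by apply: (mulIf (lt0r_neq0 m0)); rewrite divfK ?gt_eqF // mulrC -/c; lra.
rewrite EE E0; split=> [|[k fk]]; first by exists c.
by rewrite -(ae_c k fk).
Qed.

(** * Orthonormal bases and inner products of endomorphisms *)

(** One step of Gram-Schmidt: the row operation [K] clears the first row and
    column of [G], and the remaining block [S], the Schur complement of the
    corner [a], is again symmetric and positive definite. *)
Lemma posdef_orthonormalizable {R : rcfType} {n : nat} {G : 'M[R]_n} :
  G^T = G -> (forall v : 'rV[R]_n, v != 0 -> 0 < (v *m G *m v^T) 0 0) ->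
  exists P : 'M[R]_n, P *m G *m P^T = 1%:M.
Proof.
elim: n G => [|n IHn] G symG posG; first by exists 1%:M; apply/matrixP => -[].
pose a := G 0 0.
have a0 : 0 < a.
  have := posG (delta_mx 0 0); rewrite -rowE trmx_delta -colE !mxE; apply.
  apply/eqP => /matrixP /(_ 0 0); rewrite !mxE !eqxx; exact/eqP/oner_neq0.
pose G' : 'M[R]_(1 + n) := G.
have posG' (v : 'rV[R]_(1 + n)) : v != 0 -> 0 < (v *m G' *m v^T) 0 0.
  exact: posG.
have symG' : G'^T = G' by exact: symG.
pose c := dlsubmx G'.
pose D := drsubmx G'.
have Gb : G' = block_mx a%:M c^T c D.
  rewrite -[LHS]submxK -/D -/c; congr block_mx.
    by rewrite [LHS]mx11_scalar !mxE !lshift0.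
  by rewrite /c trmx_dlsub symG'.
pose w := - a^-1 *: c.
pose K : 'M[R]_(1 + n) := block_mx 1%:M 0 w 1%:M.
pose S := D + w *m c^T.
have wac : w *m a%:M + c = 0.
  by rewrite mul_mx_scalar /w scalerA mulrN mulfV ?gt_eqF // scaleN1r addNr.
have KGK : K *m G' *m K^T = block_mx a%:M 0 0 S.
  rewrite Gb /K tr_block_mx mulmx_block !mul1mx !mul0mx !addr0 wac.
  rewrite mulmx_block !trmx1 !trmx0 !mulmx0 !mulmx1 !mul0mx !addr0 !add0r.
  congr block_mx; last by rewrite /S addrC.
  by have := congr1 trmx wac; rewrite linearD /= trmx_mul tr_scalar_mx trmx0.
have symD : D^T = D by rewrite /D trmx_drsub symG'.
have symS : S^T = S.
  rewrite /S linearD /= symD trmx_mul trmxK /w linearZ /=.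
  by rewrite -scalemxAr scalemxAl.
have posS (v : 'rV[R]_n) : v != 0 -> 0 < (v *m S *m v^T) 0 0.
  move=> v0.
  have := posG' (row_mx 0 v *m K : 'rV_(1 + n)).
  rewrite trmx_mul !mulmxA -(mulmxA _ K G') -(mulmxA _ (K *m G')) KGK.
  rewrite mul_row_block !mulmx1 !mul0mx !add0r => posv.
  have : row_mx (v *m w) v != 0.
    by apply: contra_neq v0 => /eqP; rewrite row_mx_eq0 => /andP[_ /eqP].
  move=> /posv; rewrite mul_row_block !mul0mx mulmx0 !add0r.
  by rewrite tr_row_mx mul_row_col trmx0 mul0mx add0r.
have [Q QS] := IHn S symS posS.
suff [P PG] : exists P : 'M[R]_(1 + n), P *m G' *m P^T = 1%:M by exists P.
exists (block_mx ((Num.sqrt a)^-1)%:M 0 0 Q *m K).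
rewrite trmx_mul !mulmxA -(mulmxA _ K G') -(mulmxA _ (K *m G')) KGK.
rewrite tr_block_mx !mulmx_block !(mul0mx, mulmx0, addr0, add0r, trmx0) QS.
rewrite tr_scalar_mx -!scalar_mxM mulrAC -invfM -expr2 sqr_sqrtr ?ltW //.
by rewrite mulVf ?gt_eqF // -scalar_mx_block.
Qed.

(** Passes from the sum over pairs k < l that defines the norm of a 2-form to
    the full double sum, which factors. *)
Lemma sum_alternating_pairs (R : zmodType) (n : nat) (f : 'I_n -> 'I_n -> R) :
  (forall k l, f k l = f l k) -> (forall k, f k k = 0) ->
  \sum_k \sum_l f k l = (\sum_(k < n) \sum_(l < n | (k < l)%N) f k l) *+ 2.
Proof.
move=> fC f0.
transitivity (\sum_(k < n) (\sum_(l < n | (k < l)%N) f k l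
                      + \sum_(l < n | (l < k)%N) f k l)).
  apply: eq_bigr => k _.
  rewrite (bigID (fun l : 'I_n => (k < l)%N)) /=; congr (_ + _).
  rewrite (bigD1 k) ?ltnn //= f0 add0r; apply: eq_bigl => l.
  by rewrite -leqNgt ltn_neqAle andbC.
rewrite big_split /= mulr2n; congr (_ + _).
rewrite (exchange_big_dep xpredT) //=.
by apply: eq_bigr => l _; apply: eq_bigr => k _; exact: fC.
Qed.

Lemma mulmx1_invmx {R : comUnitRingType} {k : nat} {A B : 'M[R]_k} :
  A *m B = 1%:M -> A = invmx B.
Proof.
move=> AB; have [_ uB] := mulmx1_unit AB.
by rewrite -[LHS]mulmx1 -(mulmxV uB) mulmxA AB mul1mx.
Qed.

(** The reason why the norm of a 2-form does not depend on the orthonormal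
    basis: a basis enters only through P^T P, the inverse metric. *)
Lemma gram_inverse {R : comUnitRingType} {k : nat} {P G : 'M[R]_k} :
  P *m G *m P^T = 1%:M -> P^T *m P = invmx G.
Proof. by move=> PG; apply: mulmx1_invmx; rewrite -mulmxA; exact: mulmx1C. Qed.

Section EndInner.
Context (R : realType) (r : nat).
Implicit Types (H P S U T : 'M[R]_r).

(** In the orthonormal basis given by [P], the endomorphism [S] has the matrix
    [W] and <S, S> = trace (W^T W). *)
Lemma end_inner_ge0 H P S : P *m H *m P^T = 1%:M -> 0 <= end_inner H S S.
Proof.
move=> PH; have [uPH uPT] := mulmx1_unit PH.
have uP : P \in unitmx by rewrite -unitmx_tr.
rewrite /end_inner /adjoint_mx -(gram_inverse PH).
have -> : H = invmx P *m invmx P^T.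
  by rewrite -[LHS](mulKmx uP) -(mulmxK uPT (P *m H)) PH mul1mx.
pose W := invmx P^T *m S *m P^T.
have -> : P^T *m P *m S^T *m (invmx P *m invmx P^T) *m S
    = P^T *m (W^T *m (invmx P^T *m S)).
  by rewrite /W !trmx_mul trmxK trmx_inv trmxK !mulmxA.
rewrite mxtrace_mulC -mulmxA -/W /mxtrace sumr_ge0 // => s _.
by rewrite mxE sumr_ge0 // => t _; rewrite mxE -expr2 sqr_ge0.
Qed.

Lemma end_inner_change_frame T H S S' U U' :
  T \in unitmx -> H \in unitmx ->
  T *m S' = S *m T -> T *m U' = U *m T ->
  end_inner (T^T *m H *m T) S' U' = end_inner H S U.
Proof.
move=> uT uH TS TU.
have uTt : T^T \in unitmx by rewrite unitmx_tr.
have -> : S' = invmx T *m S *m T by rewrite -mulmxA -TS mulKmx.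
have -> : U' = invmx T *m U *m T by rewrite -mulmxA -TU mulKmx.
rewrite /end_inner /adjoint_mx.
have <- : invmx T *m invmx H *m invmx T^T = invmx (T^T *m H *m T).
  apply: mulmx1_invmx; rewrite !mulmxA (mulmxKV uTt) -(mulmxA _ _ H).
  by rewrite (mulVmx uH) mulmx1 (mulVmx uT).
rewrite !trmx_mul trmx_inv -!mulmxA mxtrace_mulC !mulmxA.
by rewrite !(mulmxKV uTt) !(mulmxK uT).
Qed.

Lemma end_inner_sumr H (I : Type) (s : seq I) (c : I -> R)
    (F : I -> 'M[R]_r) S :
  end_inner H S (\sum_(u <- s) c u *: F u) =
  \sum_(u <- s) c u * end_inner H S (F u).
Proof.
rewrite /end_inner mulmx_sumr raddf_sum /=; apply: eq_bigr => u _.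
by rewrite -scalemxAr mxtraceZ.
Qed.

Lemma end_inner_suml H (I : Type) (s : seq I) (c : I -> R)
    (F : I -> 'M[R]_r) S :
  end_inner H (\sum_(u <- s) c u *: F u) S =
  \sum_(u <- s) c u * end_inner H (F u) S.
Proof.
rewrite /end_inner /adjoint_mx raddf_sum /= mulmx_sumr !mulmx_suml raddf_sum /=.
apply: eq_bigr => u _.
by rewrite linearZ /= -scalemxAr -!scalemxAl mxtraceZ.
Qed.

Lemma end_innerNN H S : end_inner H (- S) (- S) = end_inner H S S.
Proof.
rewrite /end_inner /adjoint_mx.
have -> : (- S)^T = - S^T by apply/matrixP => s t; rewrite !mxE.
by rewrite !(mulmxN, mulNmx) opprK.
Qed.

End EndInner.

(** * The norm of the curvature *)

Section CurvatureNorm.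
Context (R : realType) (n r : nat) (M : ptopologicalType) (A : atlas R n M).
Context (E : vector_bundle A r) (g : riemannian_metric A) (h : fiber_metric E).

Implicit Types (F : end_tensor2 E) (a b : frame E) (i j : chart A) (x : M).

(** The zero form, the default value of the choice, is a Borel 2-form too. *)
Lemma curvature_is_end_2form (nabla : connection E) :
  is_end_2form (curvature nabla).
Proof.
rewrite /curvature; case: xgetP => [F _ [] //|_]; split.
- move=> a i k l s t; rewrite (_ : (fun x => _) = cst 0) //.
  by apply/funext => x; rewrite mxE.
- by move=> *; rewrite oppr0.
- by move=> *; rewrite mulmx0 mul0mx.
- by move=> *; rewrite big1 // => p _; rewrite big1 // => q _; rewrite scaler0.
Qed.

Lemma trans_unitmx a b x : fdom a x -> fdom b x -> trans a b x \in unitmx.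
Proof.
move=> ax bx; have := trans_cocycle ax bx ax.
by rewrite trans_id // => /mulmx1_unit[].
Qed.

Lemma gmat_unitmx i x : dom i x -> gmat g i x \in unitmx.
Proof.
move=> ix; have [P] := posdef_orthonormalizable (gmat_sym g ix)
  (fun v => gmat_pos (v := v) g ix).
by rewrite -mulmxA => /mulmx1_unit[_]; rewrite unitmx_mul => /andP[].
Qed.

Lemma hmat_orthonormalizable a x : fdom a x ->
  exists P : 'M[R]_r, P *m hmat h a x *m P^T = 1%:M.
Proof.
move=> ax; apply: posdef_orthonormalizable; first exact: (hmat_sym h ax).
move=> v v0; rewrite -{1}(trmxK v); apply: (hmat_pos h ax).
by apply: contra_neq v0 => /(congr1 trmx); rewrite trmxK trmx0.
Qed.

Lemma hmat_unitmx a x : fdom a x -> hmat h a x \in unitmx.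
Proof.
move=> /hmat_orthonormalizable[P].
by rewrite -mulmxA => /mulmx1_unit[_]; rewrite unitmx_mul => /andP[].
Qed.


Lemma tensor_eval_pairs F a i x (u v : 'rV[R]_n) :
  tensor_eval F a i x u v =
  \sum_(w : 'I_n * 'I_n) (u 0 w.1 * v 0 w.2) *: F a i w.1 w.2 x.
Proof. by rewrite /tensor_eval pair_bigA. Qed.

(** The squared norm 1/2 sum g^{pp'} g^{qq'} <F_pq, F_p'q'> in terms of the
    inverse metric; no orthonormal basis has to be chosen measurably. *)
Definition gram_normsq F a i x : R :=
  2^-1 * \sum_(u : 'I_n * 'I_n) \sum_(w : 'I_n * 'I_n)
    invmx (gmat g i x) u.1 w.1 * invmx (gmat g i x) u.2 w.2
    * end_inner (hmat h a x) (F a i u.1 u.2 x) (F a i w.1 w.2 x).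

Lemma tensor_eval_alt F a i x (u v : 'rV[R]_n) : is_end_2form F ->
  dom i x -> fdom a x -> tensor_eval F a i x u v = - tensor_eval F a i x v u.
Proof.
move=> [_ alt _ _] ix ax; rewrite /tensor_eval exchange_big /= -sumrN.
apply: eq_bigr => k _; rewrite -sumrN; apply: eq_bigr => l _.
by rewrite alt // scalerN mulrC.
Qed.

Lemma normsq_in_basis_gram F a i x (P : 'M[R]_n) : is_end_2form F ->
  dom i x -> fdom a x -> orthonormal_basis g i x P ->
  normsq_in_basis h F a i x P = gram_normsq F a i x.
Proof.
move=> hF ix ax oP; rewrite /gram_normsq /normsq_in_basis /=.
set f := fun k l => end_inner (hmat h a x)
  (tensor_eval F a i x (row k P) (row l P))
  (tensor_eval F a i x (row k P) (row l P)).
have fC k l : f k l = f l k by rewrite /f tensor_eval_alt // end_innerNN.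
have f0 k : f k k = 0.
  have S0 : tensor_eval F a i x (row k P) (row k P) = 0.
    apply: (@scalerI _ _ (2 : R)); first by rewrite pnatr_eq0.
    by rewrite scaler0 scaler_nat mulr2n {2}tensor_eval_alt // subrr.
  by rewrite /f S0 /end_inner mulmx0 mxtrace0.
have n2 : (2 : R) != 0 by rewrite pnatr_eq0.
rewrite -[LHS](mulKf n2) mulr_natl -sum_alternating_pairs //.
congr (_ * _); rewrite -(gram_inverse oP) /f {fC f0 f}.
transitivity (\sum_(k < n) \sum_(l < n)
    \sum_(u : 'I_n * 'I_n) \sum_(w : 'I_n * 'I_n)
      (P k u.1 * P k w.1) * (P l u.2 * P l w.2)
    * end_inner (hmat h a x) (F a i u.1 u.2 x) (F a i w.1 w.2 x)).
  apply: eq_bigr => k _; apply: eq_bigr => l _.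
  rewrite tensor_eval_pairs end_inner_suml; apply: eq_bigr => u _.
  rewrite end_inner_sumr mulr_sumr; apply: eq_bigr => w _.
  by rewrite !mxE mulrA; congr (_ * _); ring.
under [LHS]eq_bigr => c _ do rewrite exchange_big /=.
rewrite [LHS]exchange_big /=; apply: eq_bigr => u _.
under [LHS]eq_bigr => c _ do rewrite exchange_big /=.
rewrite [LHS]exchange_big /=; apply: eq_bigr => w _.
under [LHS]eq_bigr => c _ do rewrite -mulr_suml -mulr_sumr.
rewrite -!mulr_suml; congr (_ * _ * _); rewrite mxE.
  by apply: eq_bigr => k _; rewrite mxE.
by apply: eq_bigr => l _; rewrite mxE.
Qed.

Lemma normsq_in_basis_frame F a b i x (P : 'M[R]_n) : is_end_2form F ->
  dom i x -> fdom a x -> fdom b x ->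
  normsq_in_basis h F b i x P = normsq_in_basis h F a i x P.
Proof.
move=> [_ _ Fab _] ix ax bx.
apply: eq_bigr => k _; apply: eq_bigr => l _ /=.
have S : trans a b x *m tensor_eval F b i x (row k P) (row l P) =
         tensor_eval F a i x (row k P) (row l P) *m trans a b x.
  rewrite !tensor_eval_pairs mulmx_sumr mulmx_suml; apply: eq_bigr => w _.
  by rewrite -scalemxAr -scalemxAl Fab.
rewrite (hmat_change h ax bx); apply: end_inner_change_frame => //.
  exact: trans_unitmx.
exact: hmat_unitmx.
Qed.

Lemma normsq_in_basis_chart F a i j x (P : 'M[R]_n) : is_end_2form F ->
  dom i x -> dom j x -> fdom a x ->
  normsq_in_basis h F a i x P = normsq_in_basis h F a j x (P *m jac i j x).
Proof.
move=> [_ _ _ Fij] ix jx ax.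
apply: eq_bigr => k _; apply: eq_bigr => l _ /=.
suff -> : tensor_eval F a i x (row k P) (row l P) =
  tensor_eval F a j x (row k (P *m jac i j x)) (row l (P *m jac i j x)) by [].
rewrite /tensor_eval.
transitivity (\sum_(c < n) \sum_(d < n) \sum_(p < n) \sum_(q < n)
  (P k c * jac i j x c p * (P l d * jac i j x d q)) *: F a j p q x).
  apply: eq_bigr => c _; apply: eq_bigr => d _.
  rewrite (Fij a i j) // scaler_sumr; apply: eq_bigr => p _.
  rewrite scaler_sumr; apply: eq_bigr => q _.
  by rewrite scalerA !mxE; congr (_ *: _); ring.
under [LHS]eq_bigr => c _ do rewrite exchange_big /=.
rewrite [LHS]exchange_big /=; apply: eq_bigr => p _.
under [LHS]eq_bigr => c _ do rewrite exchange_big /=.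
rewrite [LHS]exchange_big /=; apply: eq_bigr => q _.
under [LHS]eq_bigr => c _ do rewrite -scaler_suml.
rewrite -scaler_suml; congr (_ *: _).
under [LHS]eq_bigr => c _ do rewrite -mulr_sumr.
by rewrite -mulr_suml !mxE.
Qed.

Lemma orthonormal_basis_chart i j x (P : 'M[R]_n) : dom i x -> dom j x ->
  orthonormal_basis g i x P -> orthonormal_basis g j x (P *m jac i j x).
Proof.
move=> ix jx; rewrite /orthonormal_basis (gmat_change g ix jx).
by rewrite trmx_mul !mulmxA.
Qed.

Lemma orthonormal_basis_ex i x : dom i x -> exists P, orthonormal_basis g i x P.
Proof.
move=> ix; apply: posdef_orthonormalizable; first exact: (gmat_sym g ix).
by move=> v; exact: (gmat_pos g ix).
Qed.

(** An orthonormal basis for one chart is carried by the Jacobian to one for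
    the other chart, with the same values of the form on basis vectors. *)
Lemma gram_normsq_indep F a b i j x : is_end_2form F ->
  dom i x -> dom j x -> fdom a x -> fdom b x ->
  gram_normsq F a i x = gram_normsq F b j x.
Proof.
move=> hF ix jx ax bx; have [P oP] := orthonormal_basis_ex ix.
rewrite -(normsq_in_basis_gram hF ix ax oP).
rewrite -(normsq_in_basis_frame _ hF ix ax bx).
rewrite (normsq_in_basis_chart _ hF ix jx bx).
exact/normsq_in_basis_gram/orthonormal_basis_chart.
Qed.

Lemma curv_normsq_gram (nabla : connection E) a i x : dom i x -> fdom a x ->
  curv_normsq g h nabla x = gram_normsq (curvature nabla) a i x.
Proof.
have hF := curvature_is_end_2form nabla.
move=> ix ax; rewrite /curv_normsq; case: xgetP => [y _|].
  move=> [b [j [P [jx bx oP ->]]]].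
  by rewrite normsq_in_basis_gram //; exact: gram_normsq_indep.
have [P oP] := orthonormal_basis_ex ix.
by move=> /(_ (normsq_in_basis h (curvature nabla) a i x P)) []; exists a, i, P.
Qed.

Lemma curv_normsq_ge0 (nabla : connection E) x : 0 <= curv_normsq g h nabla x.
Proof.
have hF := curvature_is_end_2form nabla.
have [i ix] := dom_cover A x; have [a ax] := fdom_cover E x.
have [P oP] := orthonormal_basis_ex ix.
have [Q oQ] := hmat_orthonormalizable ax.
rewrite (curv_normsq_gram nabla ix ax) -(normsq_in_basis_gram hF ix ax oP).
rewrite sumr_ge0 // => k _; rewrite sumr_ge0 // => l _.
exact: end_inner_ge0 oQ.
Qed.

End CurvatureNorm.

(** * Continuity, measurability and compactness *)

Lemma continuous_det_at (R : realType) (T : topologicalType) (n : nat)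
    (G : T -> 'M[R]_n) (x : T) :
  (forall s t, {for x, continuous (fun y => G y s t)}) ->
  {for x, continuous (fun y => \det (G y))}.
Proof.
move=> cG; apply: cvg_big => [|s _]; first exact: add_continuous.
apply: cvgMr; apply: cvg_big => [|i _]; first exact: mul_continuous.
exact: cG.
Qed.

(** Invertibility on a neighborhood [D] is required because the inverse of a
    singular matrix is the matrix itself; on [D] Cramer's rule applies. *)
Lemma continuous_invmx_at (R : realType) (T : topologicalType) (n : nat)
    (G : T -> 'M[R]_n) (D : set T) (x : T) (s t : 'I_n) :
  open D -> (forall y, D y -> G y \in unitmx) -> D x ->
  (forall s t, {for x, continuous (fun y => G y s t)}) ->
  {for x, continuous (fun y => invmx (G y) s t)}.
Proof.
move=> oD uG Dx cG.
have E y : D y -> invmx (G y) s t = (\det (G y))^-1 * cofactor (G y) t s.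
  by move=> Dy; rewrite /invmx uG // !mxE.
have nD : \forall y \near x,
    (\det (G y))^-1 * cofactor (G y) t s = invmx (G y) s t.
  by near=> y; rewrite E //; near: y; exact: open_nbhs_nbhs.
rewrite /prop_for /continuous_at (E x Dx); apply: (cvg_trans (near_eq_cvg nD)).
apply: cvgM.
  apply: cvgV; last exact: continuous_det_at.
  by have := uG x Dx; rewrite unitmxE unitfE.
rewrite /cofactor; apply: cvgMr.
apply: (@continuous_det_at _ _ _ (fun y => row' t (col' s (G y)))) => i j.
rewrite (_ : (fun y => _) = (fun y => G y (lift t i) (lift s j))).
  exact: cG.
by apply/funext => y; rewrite !mxE.
Unshelve. all: by end_near. Qed.

Lemma open_continuous_borel (R : realType) (M : ptopologicalType) (D : set M)
    (f : M -> R) :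
  open D -> (forall x, D x -> {for x, continuous f}) ->
  measurable_fun (D : set (borel M)) (f : borel M -> measurableTypeR R).
Proof.
move=> oD cf; apply: (measurability _ (RGenOpens.measurableE R)).
move=> _ [_ [a [b ->]] <-].
suff : open (D `&` f @^-1` `]a, b[%classic) by exact: sub_sigma_algebra.
rewrite openE => x [Dx fx].
apply: filterI; first exact: open_nbhs_nbhs.
by apply: (cf x Dx); apply: open_nbhs_nbhs; split=> //; exact: interval_open.
Qed.

Lemma compact_finite_open_cover (M : ptopologicalType) (U : M -> set M) :
  compact [set: M] -> (forall x, open (U x)) -> (forall x, U x x) ->
  exists2 D : set M, finite_set D & [set: M] = \bigcup_(x in D) U x.
Proof.
rewrite compact_cover => cM oU Ux.
have [|D' _ DM] := cM M setT U (fun x _ => oU x).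
  by move=> x _; exists x.
exists [set` D']; first exact: finite_fset.
by apply/seteqP; split.
Qed.

Lemma measurable_open_cover (R : realType) (M : ptopologicalType)
    (U : M -> set M)
    (f : M -> R) :
  compact [set: M] -> (forall x, open (U x)) -> (forall x, U x x) ->
  (forall x, measurable_fun (U x : set (borel M))
     (f : borel M -> measurableTypeR R)) ->
  measurable_fun [set: borel M] (f : borel M -> measurableTypeR R).
Proof.
move=> cM oU Ux mf _ A mA; have [D fD ->] := compact_finite_open_cover cM oU Ux.
rewrite setI_bigcupl; apply: fin_bigcup_measurable => // x Dx.
by apply: mf => //; exact: sub_sigma_algebra.
Qed.

Lemma measure_open_cover_lty (R : realType) (M : ptopologicalType)
    (U : M -> set M)
    (mu : {measure set (borel M) -> \bar R}) :
  compact [set: M] -> (forall x, open (U x)) -> (forall x, U x x) ->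
  (forall x, (mu (U x) < +oo)%E) -> (mu setT < +oo)%E.
Proof.
move=> cM oU Ux muU; have [D fD DU] := compact_finite_open_cover cM oU Ux.
apply: (@le_lt_trans _ _ (\sum_(x \in D) mu (U x))%E).
  apply: content_sub_fsum => //; last by rewrite -DU.
  by move=> x _; exact: sub_sigma_algebra.
rewrite fsbig_finite //=; apply: lte_sum_pinfty => x _; exact: muU.
Qed.

Section MatrixMeasurability.
Context d (T : measurableType d) (R : realType) (D : set T).

Definition mx_measurable (m n : nat) (G : T -> 'M[R]_(m, n)) :=
  forall s t, measurable_fun D (fun x => G x s t).

Lemma mx_measurable_mul (m n p : nat) (G : T -> 'M[R]_(m, n))
    (H : T -> 'M[R]_(n, p)) :
  mx_measurable G -> mx_measurable H -> mx_measurable (fun x => G x *m H x).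
Proof.
move=> mG mH s t; under eq_fun do rewrite mxE.
by apply: measurable_sum => j; exact: measurable_funM.
Qed.

Lemma mx_measurable_tr (m n : nat) (G : T -> 'M[R]_(m, n)) :
  mx_measurable G -> mx_measurable (fun x => (G x)^T).
Proof. by move=> mG s t; under eq_fun do rewrite mxE; exact: mG. Qed.

Lemma measurable_end_inner (r : nat) (H S U : T -> 'M[R]_r) :
  mx_measurable (fun x => invmx (H x)) -> mx_measurable H ->
  mx_measurable S -> mx_measurable U ->
  measurable_fun D (fun x => end_inner (H x) (S x) (U x)).
Proof.
move=> mV mH mS mU; apply: measurable_sum => s.
by do 3?[apply: mx_measurable_mul => //]; exact: mx_measurable_tr.
Qed.

End MatrixMeasurability.

Section Measurability.
Context (R : realType) (n r : nat) (M : ptopologicalType) (A : atlas R n M).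

(** Smoothness is expressed in coordinates; on the domain of the chart it
    gives back continuity on the manifold. *)
Lemma smooth_on_chart_continuous (W : normedModType R) (i : chart A) (D : set M)
    (f : M -> W) (x : M) :
  open D -> D `<=` dom i -> smooth_on (phi i @` D) (f \o psi i) -> D x ->
  {for x, continuous f}.
Proof.
move=> oD Di /(_ 0%N)[/= cf _] Dx.
have nD : \forall y \near x, (f \o psi i) (phi i y) = f y.
  near=> y; have Dy : D y by near: y; exact: open_nbhs_nbhs.
  by rewrite /= phiK //; exact: Di.
rewrite /prop_for /continuous_at -{2}(phiK (Di _ Dx)).
apply: (cvg_trans (near_eq_cvg nD)).
apply: (@continuous_comp _ _ _ (phi i) (f \o psi i) x).
  exact/phi_continuous/Di.
by apply: cf; exists x.
Unshelve. all: by end_near. Qed.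

Lemma continuous_entry (T : topologicalType) (m p : nat) (G : T -> 'M[R]_(m, p))
    (x : T) s t :
  {for x, continuous G} -> {for x, continuous (fun y => G y s t)}.
Proof.
move=> cG.
apply: (@continuous_comp _ _ _ G (fun N : 'M[R]_(m, p) => N s t) x) => //.
exact: coord_continuous.
Qed.

Context (g : riemannian_metric A).

Lemma gmat_continuous i x : dom i x -> {for x, continuous (gmat g i)}.
Proof.
exact: (smooth_on_chart_continuous (@dom_open _ _ _ A i) _
  (@gmat_smooth _ _ _ _ g i)).
Qed.

Context (E : vector_bundle A r) (h : fiber_metric E).

Lemma hmat_continuous (a : frame E) (i : chart A) x :
  dom i x -> fdom a x -> {for x, continuous (hmat h a)}.
Proof.
move=> ix ax.
apply: (smooth_on_chart_continuous _ _ (@hmat_smooth _ _ _ _ _ _ h a i)) => //.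
by apply: openI; [exact: dom_open|exact: fdom_open].
Qed.

(** Measurability is local on a compact space, and on the domain of one chart
    and one frame the Gram matrix formula applies. *)
Lemma measurable_curv_normsq (nabla : connection E) :
  compact [set: M] ->
  measurable_fun [set: borel M]
    (curv_normsq g h nabla : borel M -> measurableTypeR R).
Proof.
move=> cM.
have /choice[i ix] := dom_cover A; have /choice[a ax] := fdom_cover E.
pose U x := dom (i x) `&` fdom (a x).
have oU x : open (U x) by apply: openI; [exact: dom_open|exact: fdom_open].
apply: (measurable_open_cover cM oU) => [x|x0]; first by split.
apply: (@eq_measurable_fun _ _ (borel M) (measurableTypeR R) _
  (gram_normsq g h (curvature nabla) (a x0) (i x0))).
  move=> x /set_mem[ix0 ax0].
  by rewrite (curv_normsq_gram g h nabla ix0 ax0).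
have cg x : U x0 x -> {for x, continuous (gmat g (i x0))}.
  by move=> [? _]; exact: gmat_continuous.
have ch x : U x0 x -> {for x, continuous (hmat h (a x0))}.
  by move=> [? ?]; exact: hmat_continuous.
have [mF _ _ _] := curvature_is_end_2form nabla.
apply: measurable_funM => //.
apply: measurable_sum => u; apply: measurable_sum => w.
have mG s t : measurable_fun (U x0 : set (borel M))
    ((fun x => invmx (gmat g (i x0) x) s t) : borel M -> measurableTypeR R).
  apply: open_continuous_borel => // x Ux.
  apply: (continuous_invmx_at (oU x0)) => //.
    by move=> y [? _]; exact: gmat_unitmx.
  by move=> ? ?; apply: continuous_entry; exact: cg.
apply: measurable_funM; first by apply: measurable_funM; exact: mG.
apply: measurable_end_inner => s t; last 2 first.
- exact: mF.
- exact: mF.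
- apply: open_continuous_borel => // x Ux.
  apply: (continuous_invmx_at (oU x0)) => //.
    by move=> y [_ ?]; exact: hmat_unitmx.
  by move=> ? ?; apply: continuous_entry; exact: ch.
- by apply: open_continuous_borel => // x Ux; apply: continuous_entry; exact: ch.
Qed.

End Measurability.

(** * Finiteness of the Riemannian volume *)

(** The integral of a nonnegative function is a supremum over the simple
    functions below it, hence monotone even for nonmeasurable [f] and [D].  This
    avoids proving that charts map Borel sets to measurable sets. *)
Lemma integral_le_cst_measure d (T : measurableType d) (R : realType)
    (mu : {measure set T -> \bar R}) (D Q : set T) (f : T -> R) (c : R) :
  measurable Q -> D `<=` Q -> 0 <= c ->
  (forall x, D x -> 0 <= f x <= c) ->
  (\int[mu]_(x in D) (f x)%:E <= c%:E * mu Q)%E.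
Proof.
move=> mQ DQ c0 fc.
rewrite -(integral_cst mu mQ) ge0_integralE; last first.
  by move=> x /fc /andP[]; rewrite lee_fin.
rewrite ge0_integralE; last by move=> x _; rewrite lee_fin.
apply: le_ereal_sup => _ [s /= sf <-]; exists s => //= x.
apply: le_trans (sf x) _; rewrite !patchE.
have [/set_mem Dx|_] := boolP (x \in D).
  by rewrite mem_set /= ?lee_fin; [case/andP: (fc x Dx)|exact: DQ].
by case: ifP; rewrite lee_fin.
Qed.

(** By induction on the dimension, as a cube is the product of a cube of lower
    dimension and an interval. *)
Lemma lebesgue_tuple_cube_lty (R : realType) (n : nat) (a b : R) :
  let Q := [set t : n.-tuple (measurableTypeR R) |
    forall i, `]a, b[%classic (tnth t i)] in
  measurable Q /\ (lebesgue_tuple R n Q < +oo)%E.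
Proof.
move=> Q; have mQ m : measurable
    [set t : m.-tuple (measurableTypeR R) |
      forall i, `]a, b[%classic (tnth t i)].
  rewrite (_ : mkset _ = \bigcap_(i : 'I_m)
      ((@tnth m _)^~ i @^-1` `]a, b[%classic)); last first.
    by apply/seteqP; split=> t /= H i; [move=> _; exact: H|exact: H].
  apply: fin_bigcap_measurable => // i _.
  rewrite -[X in measurable X]setTI; apply: measurable_tnth => //.
split; first exact: mQ.
rewrite {}/Q; elim: n => [|n IHn] /=.
  by rewrite diracE; case: (_ \in _); rewrite ltry.
rewrite /pushforward.
rewrite (_ : _ @^-1` _ = [set t : n.-tuple (measurableTypeR R) |
    forall i, `]a, b[%classic (tnth t i)] `*` `]a, b[%classic); last first.
  apply/seteqP; split=> -[t y] /=.
    move=> H; split; last by have := H ord0; rewrite tnth0.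
    by move=> i; have := H (lift ord0 i); rewrite tnthS.
  by move=> [H Hy] i; case: (unliftP ord0 i) => [j ->|->]; rewrite ?tnthS ?tnth0.
rewrite product_measure1E //; last exact: mQ.
apply: lte_mul_pinfty => //; first by rewrite ge0_fin_numE.
have lty : (@lebesgue_measure R `]a, b[%classic < +oo)%E.
  by rewrite lebesgue_measure_itv /=; case: ifP; rewrite ?ltry.
exact: lty.
Qed.

Lemma ler_mx_norm_entry (R : realType) (m n : nat) (v : 'M[R]_(m, n)) s t :
  `|v s t| <= `|v|.
Proof.
rewrite [leRHS]mx_normrE; exact: (le_bigmax _ (fun ij => `|v ij.1 ij.2|) (s, t)).
Qed.

(** The neighborhood is the preimage of a small ball of the chart, on which
    det g stays below its value at the center plus one. *)
Lemma riemannian_volume_locally_finite (R : realType) (n : nat)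
    (M : ptopologicalType) (A : atlas R n M) (g : riemannian_metric A)
    (dv : {measure set (borel M) -> \bar R}) (x : M) :
  is_riemannian_volume g dv ->
  exists U, [/\ open U, U x & (dv (U : set (borel M)) < +oo)%E].
Proof.
move=> hdv; have [i ix] := dom_cover A x.
pose v0 := phi i x.
have Ov0 : (phi i @` dom i) v0 by exists x.
have cdet : {for v0, continuous (fun v => \det (gmat g i (psi i v)))}.
  apply: continuous_det_at => s t; apply: continuous_entry.
  by have [/= cf _] := gmat_smooth g i 0%N; exact: cf.
pose c := \det (gmat g i (psi i v0)) + 1.
have : \forall v \near v0, \det (gmat g i (psi i v)) < c.
  have := cdet _ (open_nbhs_nbhs (conj (@open_lt _ c) (_ : [set y | y < c] _))).
  by apply; rewrite /= /c ltrDl.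
move=> /nbhs_ballP[e /= e0 be].
exists (dom i `&` phi i @^-1` ball v0 e).
have oU : open (dom i `&` phi i @^-1` ball v0 e).
  rewrite openE => y [iy By]; apply: filterI.
    by apply: open_nbhs_nbhs; split=> //; exact: dom_open.
  apply: (phi_continuous iy); apply: open_nbhs_nbhs; split=> //.
  exact: ball_open.
split=> //; first by split=> //; exact: ballxx.
rewrite (hdv i); first last.
- by move=> y [].
- exact: sub_sigma_algebra.
pose K := `|v0| + e.
pose Q := [set t : n.-tuple (measurableTypeR R) |
  forall j, `](- K), K[%classic (tnth t j)].
have [mQ Qoo] : measurable Q /\ (lebesgue_tuple R n Q < +oo)%E.
  exact: lebesgue_tuple_cube_lty.
apply: (@le_lt_trans _ _ ((Num.sqrt c)%:E * lebesgue_tuple R n Q)%E); last first.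
  by apply: lte_mul_pinfty => //; rewrite lee_fin sqrtr_ge0.
apply: integral_le_cst_measure => //.
- move=> t [y [iy]]; rewrite /= => By yt j.
  have : `|row_of_tuple t| < K.
    rewrite -yt -(subrK v0 (phi i y)) addrC.
    apply: le_lt_trans (ler_normD _ _) _; rewrite ltrD2l -normrN opprB.
    by move: By; rewrite mx_norm_ball.
  rewrite /Q /= in_itv /= -ltr_norml; apply: le_lt_trans.
  have := ler_mx_norm_entry (row_of_tuple t) 0 j.
  by rewrite mxE.
- move=> t [y [iy]]; rewrite /= => By yt.
  rewrite sqrtr_ge0 /= ler_wsqrtr // ltW //; apply: be; by rewrite -yt.
Qed.

Lemma riemannian_volume_lty (R : realType) (n : nat) (M : ptopologicalType)
    (A : atlas R n M) (g : riemannian_metric A)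
    (dv : {measure set (borel M) -> \bar R}) :
  compact [set: M] -> is_riemannian_volume g dv -> (dv [set: borel M] < +oo)%E.
Proof.
move=> cM hdv.
have /choice[U hU] := fun x => riemannian_volume_locally_finite x hdv.
by apply: (measure_open_cover_lty cM (U := U)) => x; case: (hU x).
Qed.

Lemma ae_imply d (T : measurableType d) (R : realType)
    (mu : {measure set T -> \bar R}) (P Q : T -> Prop) :
  (forall x, P x -> Q x) -> {ae mu, forall x, P x} -> {ae mu, forall x, Q x}.
Proof. by move=> PQ; apply: filterS => x; exact: PQ. Qed.

(** * The exponential Yang-Mills inequality *)

Theorem theorem9p1 (R : realType) (n r : nat) (M : ptopologicalType)
    (M_compact : compact [set: M]) (M_hausdorff : hausdorff_space M)
    (A : atlas R n M) (g : riemannian_metric A)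
    (dv : {measure set (borel M) -> \bar R})
    (dv_volume : is_riemannian_volume g dv)
    (E : vector_bundle A r) (h : fiber_metric E)
    (nabla : connection E) (nabla_W : in_W g h dv nabla) :
  (expeR (YM g h dv nabla / dv [set: borel M]) - 1
     <= YMe0 g h dv nabla / dv [set: borel M])%E /\
  ((expeR (YM g h dv nabla / dv [set: borel M]) - 1
      = YMe0 g h dv nabla / dv [set: borel M])%E <->
   exists c : R, {ae dv, forall x, curv_norm g h nabla x = c}).
Proof.
case: nabla_W => _ YMe0_fin.
have normsq_ge0 x := curv_normsq_ge0 g h nabla x.
have [||||le_YM eq_YM] :=
    @expR_jensen _ (borel M) R dv (fun x => curv_normsq g h nabla x / 2).
- by apply: measurable_funM => //; exact: measurable_curv_normsq.
- by move=> x; rewrite divr_ge0.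
- exact: (riemannian_volume_lty M_compact dv_volume).
- exact: YMe0_fin.
split; first exact: le_YM.
apply: (iff_trans eq_YM); split=> -[c fc].
  exists (Num.sqrt (c * 2)); apply: ae_imply fc => x /= <-.
  by rewrite divfK ?pnatr_eq0.
exists (c ^+ 2 / 2); apply: ae_imply fc => x /= <-.
by rewrite sqr_sqrtr.
Qed.
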